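(* Let $G$ be an insoluble finite group. Then the induced solubility graph $\Delta_S(G)$ is Eulerian if and only if $|R(G)|$ is odd and, for every element $x\in G$, $|\mathrm{Sol}_G(x)|$ is even.
   Context: For a finite group $G$: $R(G)$ is the soluble radical (the largest soluble normal subgroup); $\mathrm{Sol}_G(x)=\{y\in G\mid\langle x,y\rangle\text{ is soluble}\}$ for $x\in G$. The induced solubility graph $\Delta_S(G)$ is the simple graph with vertex set $G\setminus R(G)$ in which two distinct vertices $x,y$ are adjacent if and only if $\langle x,y\rangle$ is soluble. A graph is Eulerian if it contains an Eulerian cycle, i.e. a closed trail passing through each edge exactly once. *)

(* Defs.v *)
From mathcomp Require Import all_boot all_fingroup nilpotent.

Set Implicit Arguments.
Unset Strict Implicit.
Unset Printing Implicit Defensive.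

Import GroupScope.

Record sgraph := SGraph {
  vertex :> finType;
  adj : rel vertex;
  adj_sym : symmetric adj;
  adj_irr : irreflexive adj }.

Section Eulerian.

Variable D : sgraph.

Definition edges : {set {set D}} :=
  [set [set p.1; p.2] | p : D * D & adj p.1 p.2].

(* The sequence c = [:: x_0; ..; x_(n-1)] stands for the closed walk
   x_0, ..., x_(n-1), x_0, whose last edge joins x_(n-1) to x_0. *)
Definition walk_edges (c : seq D) : seq {set D} :=
  [seq [set p.1; p.2] | p <- zip c (rot 1 c)].

Definition closed_trail (c : seq D) : bool :=
  path.cycle (@adj D) c && uniq (walk_edges c).

Definition eulerian_cycle (c : seq D) : Prop :=
  closed_trail c /\
  forall E : {set D}, E \in edges -> count_mem E (walk_edges c) = 1%N.

Definition eulerian : Prop := exists c : seq D, eulerian_cycle c.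

End Eulerian.

Section Solubility.

Variables (gT : finGroupType) (G : {group gT}).

(* The subgroup generated by all soluble normal subgroups of G; by
   sol_radicalP below it is the largest soluble normal subgroup. *)
Definition sol_radical : {group gT} :=
  <<\bigcup_(H : {group gT} | (H <| G) && solvable H) H>>%G.

Lemma sol_radicalP :
  [/\ sol_radical <| G, solvable sol_radical
    & forall H : {group gT}, H <| G -> solvable H -> H \subset sol_radical].
Proof.
have sub (H : {group gT}) : H <| G -> solvable H -> H \subset sol_radical.
  move=> nH sH; apply: subset_trans (subset_gen _).
  by apply: (bigcup_sup H); rewrite ?nH ?sH.
have solM (H K : {group gT}) : H <| G -> solvable H -> K <| G -> solvable K ->
    solvable (H <*> K).
  move=> /andP[sHG nHG] sH /andP[sKG nKG] sK.
  have nHK : K \subset 'N(H) := subset_trans sKG nHG.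
  have nHHK : H <| H <*> K by rewrite normalYl.
  rewrite (series_sol nHHK) sH /= quotientYidl //.
  exact: quotient_sol.
have [H /maxgroupP[/andP[nH sH] maxH]] :
    {H : {group gT} | [max H | (H <| G) && solvable H]}.
  by apply: ex_maxgroup; exists 1%G; rewrite normal1 solvable1.
suff -> : sol_radical = H.
  split=> // K nK sK.
  by rewrite -(maxH (H <*> K)%G) ?joing_subr ?joing_subl ?normalY ?solM.
apply/val_inj/eqP; rewrite eqEsubset sub // andbT gen_subG.
apply/bigcupsP=> K /andP[nK sK].
by rewrite -(maxH (H <*> K)%G) ?joing_subr ?joing_subl ?normalY ?solM.
Qed.

Definition Sol (x : gT) : {set gT} :=
  [set y in G | solvable <<[set x; y]>>].

Definition sol_vertex : finType := {x : gT | x \in G :\: sol_radical}.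

Definition sol_adj (x y : sol_vertex) : bool :=
  (x != y) && solvable <<[set val x; val y]>>.

Lemma sol_adj_sym : symmetric sol_adj.
Proof. by move=> x y; rewrite /sol_adj eq_sym setUC. Qed.

Lemma sol_adj_irr : irreflexive sol_adj.
Proof. by move=> x; rewrite /sol_adj eqxx. Qed.

Definition sol_graph : sgraph := SGraph sol_adj_sym sol_adj_irr.

End Solubility.

(* Main.v *)
Require Import Defs.
From mathcomp Require Import all_boot all_fingroup cyclic pgroup nilpotent.

(** Write R for the soluble radical and Sol x for the solubiliser of x.

    Counting. If H is a soluble subgroup of G then so is H R, hence Sol x
    contains R and is stable under right multiplication by R. For a vertex x
    this gives deg x = |Sol x| - |R| - 1 (degree_Sol), so deg x is even exactly
    when |Sol x| and |R| have different parities. If |R| were even, right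
    multiplication by an involution of R would pair off the elements of Sol x,
    so |Sol x| would be even as well (even_Sol). Therefore all degrees are even
    if and only if |R| is odd and |Sol x| is even for every x outside R.

    Involutions. Inversion permutes Sol x and fixes 1, so if |Sol x| is even
    then Sol x contains an involution (Sol_involution). This serves twice:
    - for the elements x of R, where Sol x = G, it gives that |G| is even,
      since G, being insoluble, has an element outside R;
    - conversely, if |R| is odd, an involution lies outside R, so every vertex
      is equal or adjacent to an involution; as two involutions generate a
      dihedral group, which is soluble (involutions_solvable), any two
      involutions are adjacent and the graph is connected.

    What remains is Euler's theorem. Its two halves rest on one parity formula:
    a trail from x to y meets a vertex v in an odd number of edges exactly when
    v is one of x, y but not both (odd_trail_edges). *)

(** * Euler's theorem *)

Section Trails.

Set Implicit Arguments.
Unset Strict Implicit.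

Variable D : sgraph.
Implicit Types (x y v : D) (p : seq D).

(** Trails may be open here, whereas the walks of [walk_edges] are closed: open
    ones can be prolonged edge by edge. The vertices are those of x :: p, as
    for [path]. *)
Definition trail_edges x p : seq {set D} :=
  [seq [set q.1; q.2] | q <- zip (belast x p) p].

Definition trail x p := path (@adj D) x p && uniq (trail_edges x p).

Lemma trail_edges_cat x p1 p2 :
  trail_edges x (p1 ++ p2) = trail_edges x p1 ++ trail_edges (last x p1) p2.
Proof. by rewrite /trail_edges belast_cat zip_cat ?size_belast // map_cat. Qed.

Lemma trail_edges_rcons x p y :
  trail_edges x (rcons p y) = rcons (trail_edges x p) [set last x p; y].
Proof. by rewrite -cats1 trail_edges_cat cats1. Qed.

Lemma size_trail_edges x p : size (trail_edges x p) = size p.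
Proof. by rewrite size_map size2_zip ?size_belast. Qed.

Lemma mem_edges x y : ([set x; y] \in edges D) = adj x y.
Proof.
apply/imsetP/idP=> [[[a b]]|]; last by move=> xy; exists (x, y); rewrite ?inE.
rewrite inE /= => ab E.
have /set2P ax : a \in [set x; y] by rewrite E set21.
have /set2P bx : b \in [set x; y] by rewrite E set22.
case: ax bx ab => -> [->|->] //; by [rewrite adj_irr | rewrite adj_sym].
Qed.

Lemma mem_trail_edges x p (E : {set D}) :
  E \in trail_edges x p -> {subset E <= x :: p}.
Proof.
elim: p x => //= y p IH x; rewrite inE.
move=> /orP[/eqP-> v /set2P[]->|/IH Ep v /Ep].
- exact: mem_head.
- by rewrite inE mem_head orbT.
by rewrite [in X in _ -> X]inE orbC => ->.
Qed.

Lemma trail_edges_sub x p :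
  path (@adj D) x p -> {subset trail_edges x p <= edges D}.
Proof.
elim: p x => [|y p IH] x //= /andP[xy yp] E.
by rewrite inE => /orP[/eqP->|/(IH _ yp)//]; rewrite mem_edges.
Qed.

(** Every passage of the trail through v uses two edges at v; only the first
    and the last vertex contribute a single one. *)
Lemma odd_trail_edges x p v : path (@adj D) x p ->
  odd (count (fun E : {set D} => v \in E) (trail_edges x p))
    = (x == v) (+) (last x p == v).
Proof.
elim: p x => [|y p IH] x /=; first by rewrite addbb.
case/andP=> xy yp; rewrite oddD IH //= !inE ![v == _]eq_sym.
have: x != y by apply: contraTneq xy => ->; rewrite adj_irr.
by case: (eqVneq x v) => [->|_]; case: (eqVneq y v) => [->|_] //=;
  rewrite ?eqxx //; case: (last _ _ == v).
Qed.

Lemma degree_edges v :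
  #|[set y | adj v y]| = #|[set E in edges D | v \in E]|.
Proof.
have inj : {in [set y | adj v y] &, injective (fun y => [set v; y])}.
  move=> y z; rewrite !inE => vy vz /setP/(_ y).
  rewrite !inE eqxx orbT => /esym/orP[]/eqP // yv.
  by rewrite yv adj_irr in vy.
rewrite -(card_in_imset inj); apply: eq_card => E; rewrite inE.
apply/imsetP/andP=> [[y]|[/imsetP[[a b]]]].
  by rewrite inE => vy ->; rewrite mem_edges !inE eqxx.
rewrite !inE /= => ab -> /set2P[]->; first by exists b; rewrite ?inE.
by exists a; rewrite ?inE 1?adj_sym // setUC.
Qed.

Lemma size_trail x p : trail x p -> size p <= #|{set D}|.
Proof.
by case/andP=> _ u; rewrite -(size_trail_edges x) -(card_uniqP u) max_card.
Qed.

(** A trail that has used up all the edges at v meets v in deg v edges, so its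
    parity formula becomes one for the degree of v. *)
Lemma trail_full x p v : trail x p ->
  (forall y, adj v y -> [set v; y] \in trail_edges x p) ->
  odd #|[set y | adj v y]| = (x == v) (+) (last x p == v).
Proof.
case/andP=> xp u full; rewrite -odd_trail_edges // degree_edges -size_filter.
congr odd; rewrite -(card_uniqP (filter_uniq _ u)).
apply: eq_card => E; rewrite inE mem_filter andbC.
case vE: (v \in E) => //=; apply/idP/idP; last exact: trail_edges_sub.
case/imsetP=> [[a b]]; rewrite inE /= => ab EE.
move: vE; rewrite EE => /set2P[] e; first by rewrite -e full ?e.
by rewrite setUC -e full // e adj_sym.
Qed.

Lemma walk_trail_edges x p : walk_edges (x :: p) = trail_edges x (rcons p x).
Proof. by rewrite /walk_edges rot1_cons /trail_edges belast_rcons. Qed.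

(** An Eulerian cycle is a closed trail that uses up the edges at every
    vertex, and for a closed trail the two end contributions cancel. *)
Lemma eulerian_even_degree :
  eulerian D -> forall v, ~~ odd #|[set y | adj v y]|.
Proof.
case=> [[|x p] [ct all1] v].
  rewrite (_ : [set y | _] = set0) ?cards0 //; apply/setP=> y; rewrite !inE.
  by apply/negP; rewrite -mem_edges => /all1.
have {ct} tr : trail x (rcons p x).
  by move: ct; rewrite /closed_trail walk_trail_edges.
rewrite (trail_full tr) ?last_rcons ?addbb // => y.
rewrite -mem_edges => /all1; rewrite walk_trail_edges -has_pred1 has_count.
by move=> ->.
Qed.

(** Starting a closed trail at another of its vertices shifts its edges
    cyclically, so that it can be prolonged from there. *)
Lemma trail_rot x p1 p2 : last x (p1 ++ p2) = x -> trail x (p1 ++ p2) ->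
  trail (last x p1) (p2 ++ p1)
  /\ perm_eq (trail_edges (last x p1) (p2 ++ p1)) (trail_edges x (p1 ++ p2)).
Proof.
rewrite last_cat /trail => e /andP[]; rewrite !cat_path e => /andP[p1P p2P] u.
have pe: perm_eq (trail_edges (last x p1) (p2 ++ p1)) (trail_edges x (p1 ++ p2)).
  by rewrite !trail_edges_cat e perm_catC.
by rewrite (perm_uniq pe) p2P p1P u.
Qed.

(** Consider a longest trail. Its last vertex has no unused edge; since degrees
    are even, the parity formula forces the trail to be closed. Being closed, it
    can be restarted at any of its vertices, so no visited vertex has an unused
    edge. By connectedness every vertex is visited, and every edge is used. *)
Lemma even_connected_eulerian :
  (forall v, ~~ odd #|[set y | adj v y]|) ->
  (forall u v, connect (@adj D) u v) -> eulerian D.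
Proof.
move=> evenD conn.
case: (pickP (@predT D)) => [x0 _|D0]; last first.
  exists [::]; split=> // E /imsetP[[a b]].
  by have := D0 a.
pose has_trail n := [exists x, [exists p : n.-tuple D, trail x p]].
have ex0 : exists n, has_trail n.
  by exists 0; apply/existsP; exists x0; apply/existsP; exists [tuple].
have bnd n : has_trail n -> n <= #|{set D}|.
  by case/existsP=> x /existsP[p /size_trail]; rewrite size_tuple.
case: (ex_maxnP ex0 bnd) => n /existsP[x /existsP[[p /= /eqP sp] tr]] maxn.
rewrite /= in tr.
have full y q : trail y q -> size q = n -> forall z, adj (last y q) z ->
    [set last y q; z] \in trail_edges y q.
  move=> /andP[yq uq] sq z az; apply: contraT => notin.
  suff /maxn : has_trail n.+1 by rewrite ltnn.
  have sz : size (rcons q z) == n.+1 by rewrite size_rcons sq.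
  apply/existsP; exists y; apply/existsP; exists (Tuple sz).
  by rewrite /trail /= rcons_path yq az trail_edges_rcons rcons_uniq notin.
have closed : last x p = x.
  have := trail_full tr (full _ _ tr sp).
  by rewrite (negPf (evenD _)) eqxx addbT => /esym/negbFE/eqP.
have atV a b : a \in x :: p -> adj a b -> [set a; b] \in trail_edges x p.
  move=> ap ab; case/splitPl: ap sp tr closed => p1 p2 la sp tr closed.
  have [tr' pe] := trail_rot closed tr.
  have la' : last (last x p1) (p2 ++ p1) = a.
    by rewrite last_cat -(last_cat x) closed.
  rewrite -(perm_mem pe) -la'; apply: full; rewrite ?la' //.
  by rewrite size_cat addnC -size_cat.
have visited a : a \in x :: p.
  have /connectP[q] := conn x a.
  elim/last_ind: q a => [|q b IH] a /=; first by move=> _ ->; rewrite mem_head.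
  rewrite rcons_path last_rcons => /andP[xq qb] ->.
  have /(atV _ _)/(_ qb) := IH _ xq erefl.
  by move/mem_trail_edges; apply; rewrite set22.
have all_used E : E \in edges D -> E \in trail_edges x p.
  by case/imsetP=> [[a b]]; rewrite inE => ab ->; apply: atV.
case/lastP: p closed tr all_used {sp full atV visited} => [|p y].
  by move=> _ _ no_edge; exists [::]; split=> // E /no_edge.
rewrite last_rcons => -> tr all_used; exists (x :: p); split.
  by rewrite /closed_trail walk_trail_edges.
move=> E /all_used; rewrite walk_trail_edges => EE.
by rewrite count_uniq_mem ?EE //; case/andP: tr.
Qed.

End Trails.

(** * Solubilisers and involutions *)

Section SolubleGraph.

Import GroupScope.
Set Implicit Arguments.
Unset Strict Implicit.

Lemma odd_card_involution (T : finType) (f : T -> T) (A : {set T}) :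
    involutive f -> (forall x, x \in A -> f x \in A) ->
  odd #|A| = odd #|[set x in A | f x == x]|.
Proof.
move=> fK; have [n] := ubnP #|A|; elim: n A => // n IH A leAn fA.
case: (pickP [pred x in A | f x != x]) => [x /andP[/= Ax fx]|fix_]; last first.
  congr (odd _); apply: eq_card => x; have:= fix_ x; rewrite !inE.
  by case: (x \in A) => //= /negbFE.
have Afx : f x \in A :\ x by rewrite !inE fx fA.
have cA : #|A| = #|A :\ x :\ f x|.+2.
  by rewrite (cardsD1 x) Ax (cardsD1 (f x)) Afx.
rewrite cA /= negbK IH.
- congr (odd _); apply: eq_card => y; rewrite !inE.
  case: (eqVneq y x) => [->|_]; first by rewrite (negPf fx) !andbF.
  by case: (eqVneq y (f x)) => [->|_] //=; rewrite fK eq_sym (negPf fx) andbF.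
- by rewrite -ltnS (leq_trans _ leAn) // cA.
move=> y; rewrite !inE => /and3P[yfx yx Ay].
by rewrite fA // (inj_eq (inv_inj fK)) yx (can2_eq fK fK) yfx.
Qed.

(** The group is dihedral: with r = s t, conjugation by s inverts r, so <[r]>
    is a normal cyclic subgroup with cyclic quotient generated by s. *)
Lemma involutions_solvable (gT : finGroupType) (s t : gT) :
  s^-1 = s -> t^-1 = t -> solvable <<[set s; t]>>.
Proof.
move=> si ti; pose r := s * t.
have nr : <[s]> \subset 'N(<[r]>).
  rewrite norms_cycle /r conjgE si !mulgA -{1}si mulVg mul1g.
  by rewrite (_ : t * s = r^-1) ?groupV ?cycle_id // /r invMg si ti.
have sol : solvable (<[r]> <*> <[s]>).
  have nrs : <[r]> <| <[r]> <*> <[s]> by rewrite normalYl.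
  rewrite (series_sol nrs) abelian_sol ?cycle_abelian //= quotientYidl //.
  by rewrite quotient_sol // abelian_sol ?cycle_abelian.
apply: solvableS sol; rewrite gen_subG subUset !sub1set.
have ss : s \in <[r]> <*> <[s]> by rewrite mem_gen // inE cycle_id orbT.
have rr : r \in <[r]> <*> <[s]> by rewrite mem_gen // inE cycle_id.
by rewrite ss -(groupMl t ss) rr.
Qed.

Variables (gT : finGroupType) (G : {group gT}).
Local Notation R := (sol_radical G).

Lemma solvable_joinR (H : {group gT}) :
  H \subset G -> solvable H -> solvable (H <*> R).
Proof.
move=> sHG sH; have [/andP[_ nRG] sR _] := sol_radicalP G.
have nRH := subset_trans sHG nRG.
have nR : R <| H <*> R by rewrite normalYr.
by rewrite (series_sol nR) sR quotientYidr //= quotient_sol.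
Qed.

Lemma sub_radical : R \subset G.
Proof. by have [/andP[]] := sol_radicalP G. Qed.

Lemma Sol_sub x : Sol G x \subset G.
Proof. by apply/subsetP=> y; rewrite inE => /andP[]. Qed.

Lemma SolMr x y r : x \in G -> r \in R -> y \in Sol G x -> y * r \in Sol G x.
Proof.
move=> Gx Rr; rewrite !inE => /andP[Gy sxy].
rewrite groupM ?(subsetP sub_radical r) //=.
have sG : <<[set x; y]>> \subset G by rewrite gen_subG subUset !sub1set Gx.
apply: solvableS (solvable_joinR sG sxy).
have sxyJ : [set x; y] \subset <<[set x; y]>> <*> R.
  exact: subset_trans (subset_gen _) (joing_subl _ _).
have [Jx Jy] : x \in <<[set x; y]>> <*> R /\ y \in <<[set x; y]>> <*> R.
  by split; apply: (subsetP sxyJ); rewrite ?set21 ?set22.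
rewrite gen_subG subUset !sub1set Jx groupM //.
by apply: subsetP Rr; apply: joing_subr.
Qed.

Lemma Sol_self x : x \in G -> x \in Sol G x.
Proof. by move=> Gx; rewrite inE Gx setUid abelian_sol ?cycle_abelian. Qed.

Lemma radical_sub_Sol x : x \in G -> R \subset Sol G x.
Proof.
move=> Gx; apply/subsetP=> r Rr.
rewrite -[r]mul1g SolMr // inE group1 /=.
apply: solvableS (abelian_sol (cycle_abelian x)).
by rewrite gen_subG subUset !sub1set cycle_id group1.
Qed.

Lemma Sol_radical x : x \in R -> Sol G x = G.
Proof.
move=> Rx; apply/eqP; rewrite eqEsubset Sol_sub; apply/subsetP=> y Gy.
have := subsetP (radical_sub_Sol Gy) _ Rx.
by rewrite !inE setUC Gy => /andP[].
Qed.

Lemma SolV x y : y \in Sol G x -> y^-1 \in Sol G x.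
Proof.
rewrite !inE groupV => /andP[-> sxy] /=; apply: solvableS sxy.
by rewrite gen_subG subUset !sub1set groupV !mem_gen ?set21 ?set22.
Qed.

(** An involution t of R acts on Sol x by right multiplication without fixed
    points. *)
Lemma even_Sol x : x \in G -> ~~ odd #|R| -> ~~ odd #|Sol G x|.
Proof.
move=> Gx; rewrite -dvdn2 => /(Cauchy (isT : prime 2))[t Rt ot].
rewrite (@odd_card_involution _ (fun y => y * t)).
- rewrite (_ : [set _ in _ | _] = set0) ?cards0 //; apply/setP=> y.
  by rewrite !inE -[X in _ == X]mulg1 (inj_eq (mulgI y)) -order_eq1 ot andbF.
- by move=> y; rewrite -mulgA -expg2 -ot expg_order mulg1.
by move=> y; apply: SolMr.
Qed.

(** Inversion fixes 1 in Sol x, and the number of its fixed points is even, so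
    it fixes some other element as well. *)
Lemma Sol_involution x : x \in G -> ~~ odd #|Sol G x| ->
  exists t, [/\ t \in Sol G x, t^-1 = t & #[t] = 2].
Proof.
move=> Gx; rewrite (odd_card_involution invgK); last exact: SolV.
set F := [set _ in _ | _].
have F1 : 1 \in F.
  by rewrite inE (subsetP (radical_sub_Sol Gx)) ?group1 ?invg1 /=.
rewrite (cardsD1 1) F1 /= negbK => oF.
have /card_gt0P[t] : 0 < #|F :\ 1| by case: #|_| oF.
rewrite !inE => /and3P[t1 St /eqP ti]; exists t; rewrite inE.
by split=> //; apply: nt_prime_order; rewrite // expgS expg1 -{1}ti mulVg.
Qed.

(** The set Sol v is the disjoint union of R, of v itself and of the neighbours
    of v. *)
Lemma degree_Sol (v : sol_graph G) :
  (#|R| + #|[set y | adj v y]|).+1 = #|Sol G (val v)|.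
Proof.
have /setDP[Gv Rv] := valP v.
rewrite -(cardsID R (Sol G (val v))) (setIidPr (radical_sub_Sol Gv)) -addnS.
congr addn; rewrite (cardsD1 (val v)) inE Rv Sol_self // -(card_imset _ val_inj).
congr _.+1; apply: eq_card => y; apply/imsetP/idP=> [[w]|].
  rewrite !inE => /andP[vw sol] ->; have /setDP[Gw Rw] := valP w.
  by rewrite Rw Gw sol (inj_eq val_inj) eq_sym vw.
rewrite !inE => /and4P[yv Ry Gy sol].
have yV : y \in G :\: R by rewrite inE Ry.
exists (Sub y yV : sol_vertex G) => //; rewrite inE /= /sol_adj sol andbT.
by apply: contraNneq yv => ->.
Qed.

End SolubleGraph.

(** * The induced solubility graph *)

Theorem theorem4p4 (gT : finGroupType) (G : {group gT})
    (insolG : ~~ solvable G) :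
  eulerian (sol_graph G) <->
  (odd #|sol_radical G| /\ forall x : gT, x \in G -> ~~ odd #|Sol G x|).
Proof.
have parity (v : sol_graph G) : odd #|[set y | adj v y]| =
    ~~ (odd #|sol_radical G| (+) odd #|Sol G (val v)|).
  by rewrite -degree_Sol /= oddD; case: (odd _); case: (odd _).
split=> [/eulerian_even_degree evenD|[oddR evenS]].
  have [x0 x0V] : exists x, x \in G :\: sol_radical G.
    apply/set0Pn; rewrite setD_eq0; apply: contra insolG.
    by have [_ sR _] := sol_radicalP G; move/solvableS; apply.
  have main x : x \in G :\: sol_radical G ->
      odd #|sol_radical G| /\ ~~ odd #|Sol G x|.
    move=> xV; have /setDP[Gx _] := xV.
    have : odd #|sol_radical G| (+) odd #|Sol G x|.
      by have := evenD (Sub x xV : sol_vertex G); rewrite parity negbK.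
    have := even_Sol Gx.
    by case: (odd #|sol_radical G|) => [//|/(_ isT)/negPf->].
  have [oddR evS0] := main _ x0V; split=> // x Gx.
  have [Rx|nRx] := boolP (x \in sol_radical G); last first.
    by apply: (proj2 (main x _)); rewrite inE nRx.
  have /setDP[Gx0 _] := x0V.
  have [t [St ti t2]] := Sol_involution Gx0 evS0.
  rewrite Sol_radical // -dvdn2.
  by rewrite -t2 order_dvdG // (subsetP (Sol_sub G x0)).
apply: even_connected_eulerian => [v|].
  have /setDP[Gv _] := valP v.
  by rewrite parity oddR (negPf (evenS _ Gv)).
have adjC (u v : sol_graph G) : solvable <<[set val u; val v]>> ->
    connect (@adj (sol_graph G)) u v.
  move=> sol; have [->|uv] := eqVneq u v; first exact: connect0.
  by apply: connect1; rewrite /= /sol_adj uv.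
have to_inv (v : sol_graph G) : exists2 t : sol_graph G,
    connect (@adj (sol_graph G)) v t & (val t)^-1%g = val t.
  have /setDP[Gv _] := valP v.
  have [t [St ti t2]] := Sol_involution Gv (evenS _ Gv).
  have tV : t \in G :\: sol_radical G.
    rewrite inE (subsetP (Sol_sub G (val v))) // andbT.
    by apply: contraL oddR => /order_dvdG; rewrite t2 dvdn2.
  exists (Sub t tV : sol_vertex G) => //; apply: adjC.
  by move: St; rewrite inE => /andP[].
move=> u v; have [s us si] := to_inv u; have [t vt ti] := to_inv v.
apply: connect_trans us _.
apply: connect_trans (adjC _ _ (involutions_solvable si ti)) _.
by rewrite (sym_connect_sym (@adj_sym _)).
Qed.
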